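(* Let $p$ be a strongly admissible premonic pattern, let $\Lambda$ be a numerical semigroup admitting $p$, and let $a\in\Lambda$. The following conditions are equivalent: (1) $a$ belongs to the minimal $p$-system of generators of $\Lambda$; (2) $\Lambda\setminus\{a\}$ is a numerical semigroup admitting $p$.
   Context: $\mathbb{N}$ denotes the set of nonnegative integers. A numerical semigroup is a subset of $\mathbb{N}$ that contains $0$, is closed under addition and has finite complement in $\mathbb{N}$. A pattern of length $n$ is a linear homogeneous polynomial $p=\sum_{i=1}^n a_ix_i$ with all $a_i$ non-zero integers (for $n=0$ the unique pattern is $p=0$). A numerical semigroup $\Lambda$ admits $p$ if $p(s_1,\dots,s_n)\in\Lambda$ for all $s_1\geq s_2\geq\dots\geq s_n$ in $\Lambda$; $\mathcal{S}(p)$ is the set of all numerical semigroups admitting $p$. The pattern $p$ is admissible if $\mathcal{S}(p)\neq\emptyset$, equivalently if $\sum_{i=1}^{n'}a_i\ge 0$ for all $1\le n'\le n$. Set $p'=p-x_1$ if $a_1>1$ and $p'=p(0,x_1,x_2,\dots,x_{n-1})$ otherwise. The pattern $p$ is strongly admissible if both $p$ and $p'$ are admissible. The pattern $p$ is premonic if $\sum_{i=1}^{n'}a_i=1$ for some $1\le n'\leq n$. For an admissible pattern $p$, the $p$-closure of a numerical semigroup $\Lambda$ is the intersection of all $\Gamma\in\mathcal{S}(p)$ with $\Lambda\subseteq\Gamma$. For $A\subseteq\mathbb{N}$, $\langle A\rangle$ is the submonoid of $(\mathbb{N},+)$ generated by $A$. For $\Lambda\in\mathcal{S}(p)$, a set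 $A\subseteq\mathbb{N}$ is a $p$-system of generators of $\Lambda$ if $\langle A\rangle$ is a numerical semigroup whose $p$-closure is equal to $\Lambda$. It is minimal if it is minimal with respect to set inclusion among the $p$-systems of generators of $\Lambda$; when $p$ is strongly admissible and premonic, $\Lambda$ has a unique minimal $p$-system of generators. *)

(* Defs.v *)
From mathcomp Require Import all_boot all_order all_algebra.
From mathcomp Require Import all_classical.

Set Implicit Arguments.
Unset Strict Implicit.
Unset Printing Implicit Defensive.
Import GRing.Theory.

Local Open Scope classical_set_scope.
Local Open Scope ring_scope.

Definition submonoid (M : set nat) : Prop :=
  M 0%N /\ (forall x y : nat, M x -> M y -> M (x + y)%N).

Definition numerical_semigroup (L : set nat) : Prop :=
  submonoid L /\ finite_set (~` L).

Definition generated (A : set nat) : set nat := smallest submonoid A.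

(* The linear form a_1 x_1 + ... + a_n x_n is represented by its sequence of
   coefficients [:: a_1; ...; a_n]; the empty sequence is the pattern 0. *)
Definition pattern (p : seq int) : Prop := forall a : int, a \in p -> a != 0.

Definition pattern_eval (p : seq int) (s : seq nat) : int :=
  \sum_(i < size p) nth 0 p i * (nth 0%N s i)%:Z.

(* [sorted geq s] says that s is non-increasing. The value of p at s is an
   integer, and it has to be (the image of) an element of L. *)
Definition admits (L : set nat) (p : seq int) : Prop :=
  forall s : seq nat, size s = size p -> sorted geq s ->
    (forall x : nat, x \in s -> L x) ->
    exists2 y : nat, L y & pattern_eval p s = y%:Z.

Definition semigroups_admitting (p : seq int) : set (set nat) :=
  [set L | numerical_semigroup L /\ admits L p].

Definition admissible (p : seq int) : Prop := semigroups_admitting p !=set0.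

(* p' is p - x_1 when a_1 > 1, and p(0, x_1, ..., x_(n-1)) otherwise. *)
Definition derived_pattern (p : seq int) : seq int :=
  if p is a1 :: q then if 1 < a1 then (a1 - 1) :: q else q else [::].

Definition strongly_admissible (p : seq int) : Prop :=
  admissible p /\ admissible (derived_pattern p).

Definition premonic (p : seq int) : Prop :=
  exists2 m : nat, (1 <= m <= size p)%N & \sum_(a <- take m p) a = 1.

Definition pattern_closure (p : seq int) (L : set nat) : set nat :=
  smallest (semigroups_admitting p) L.

Definition generating_system (p : seq int) (L A : set nat) : Prop :=
  numerical_semigroup (generated A) /\ pattern_closure p (generated A) = L.

Definition minimal_generating_system (p : seq int) (L A : set nat) : Prop :=
  generating_system p L A /\
  (forall B : set nat, generating_system p L B -> B `<=` A -> B = A).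

(* Definite description: the unique minimal p-system of generators of L. It is
   only meaningful when such a system exists and is unique, which is the case
   for p strongly admissible and premonic and L in [semigroups_admitting p];
   otherwise [get] returns a default value. *)
Definition the_minimal_generating_system (p : seq int) (L : set nat) :
    set nat :=
  get [set A | unique (minimal_generating_system p L) A].

(* Main.v *)
(** Strong admissibility gives [p(s) >= s_1] for non-increasing [s].  Hence the
    set [M] of all [a] in [L] such that [L \ {a}] is a numerical semigroup
    admitting [p] generates [L] under addition and [p]: an element outside [M]
    is a sum or a value of [p] of strictly smaller elements of [L].  A common
    divisor of [M] then divides all of [L], so it is 1 and [<M>] is cofinite;
    thus [M] is a [p]-system of generators.  Conversely, if [A] is one and
    misses [a] in [M], then [L \ {a}] contains [A], hence [L], which is absurd.
    So [M] is the least [p]-system of generators. *)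

Require Import Defs.
From mathcomp Require Import all_boot all_order all_algebra.
From mathcomp Require Import all_classical.
From mathcomp Require Import zify.
Local Open Scope classical_set_scope.
Import GRing.Theory Num.Theory.
Set Implicit Arguments.
Unset Strict Implicit.
Unset Printing Implicit Defensive.

Definition removable (p : seq int) (L : set nat) : set nat :=
  [set a | L a /\ semigroups_admitting p (L `\ a)].

Lemma submonoid_muln (G : set nat) k x : submonoid G -> G x -> G (k * x)%N.
Proof.
by move=> [G0 GD] Gx; elim: k => [|k IHk]; rewrite ?mul0n // mulSn; apply: GD.
Qed.

Lemma cofinite_ge_n (G : set nat) n :
  (forall m, n <= m -> G m) -> finite_set (~` G).
Proof.
move=> Gn; apply: (@sub_finite_set _ _ `I_n); last exact: finite_II.
by move=> m /= NGm; rewrite ltnNge; apply/negP => /Gn.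
Qed.

(** For [m >= n * n] and [n > 0], write [m = q n + r] with [r < n <= q]; then
    [m = (q - r) n + r (n + 1)]. *)
Lemma cofinite_submonoid_consecutive (G : set nat) n :
  submonoid G -> G n -> G n.+1 -> finite_set (~` G).
Proof.
move=> Gm Gn Gn1; apply: (@cofinite_ge_n _ (n * n)%N) => m le_nn_m.
have [n0|n_gt0] := posnP n.
  by rewrite -[m]muln1; apply: submonoid_muln => //; rewrite -n0.
have lt_mod : m %% n < n by rewrite ltn_mod.
have le_div : n <= m %/ n by rewrite leq_divRL.
have -> : m = (((m %/ n) - m %% n) * n + m %% n * n.+1)%N.
  by rewrite {1}(divn_eq m n) mulnBl mulnS; nia.
by apply: Gm.2; apply: submonoid_muln.
Qed.

(* The least positive difference [d] of two elements of [G] divides every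
   element of [G]: if [x = y + d] and [g = q d + r], then [g + q y] and [q x]
   differ by [r]. *)
Lemma cofinite_submonoid_coprime (G : set nat) :
  submonoid G -> (forall d, (forall g, G g -> d %| g) -> d = 1%N) ->
  finite_set (~` G).
Proof.
move=> Gm G_coprime.
pose D d := `[< 0 < d /\ exists2 y, G y & G (y + d)%N >].
have exD : exists d, D d.
  (* Without positive differences [G] is zero, so 2 divides all its elements. *)
  apply: contrapT => noD; suff: 2%N = 1%N by [].
  apply: G_coprime => g Gg; case: (posnP g) => [->//|g_gt0].
  by case: noD; exists g; apply/asboolP; split=> //; exists 0%N => //; case: Gm.
case: (ex_minnP exD) => d /asboolP[d_gt0 [y Gy Gyd]] d_min.
have d1 : d = 1%N.
  apply: G_coprime => g Gg; rewrite /dvdn; apply: contrapT => /negP.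
  rewrite -lt0n => r_gt0.
  suff /d_min : D (g %% d)%N by rewrite leqNgt ltn_mod d_gt0.
  apply/asboolP; split=> //; exists ((g %/ d) * (y + d))%N.
    exact: submonoid_muln.
  have -> : ((g %/ d) * (y + d) + g %% d = g + (g %/ d) * y)%N.
    by rewrite {3}(divn_eq g d) mulnDr; lia.
  by apply: Gm.2 => //; apply: submonoid_muln.
by apply: (cofinite_submonoid_consecutive Gm Gy); rewrite -addn1 -d1.
Qed.

(** If [d != 1] divides all of [L], then [L] has no two consecutive elements: each [n] is a gap or
    precedes one, so finitely many gaps would make [nat] finite. *)
Lemma numerical_semigroup_coprime (L : set nat) d :
  numerical_semigroup L -> (forall g, L g -> d %| g) -> d = 1%N.
Proof.
move=> [_ Lfin] dL; apply: contrapT => d_neq1.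
apply: infinite_nat.
apply: (@sub_finite_set _ _ (~` L `|` (fun x => x.-1) @` ~` L)).
  move=> n _; have [Ln|] := pselect (L n); last by left.
  right; exists n.+1 => //= /dL dn1; apply: d_neq1; apply/eqP.
  by rewrite -dvdn1 -(dvdn_addr 1 (dL _ Ln)) addn1.
by rewrite finite_setU; split=> //; apply: finite_image.
Qed.

Lemma numerical_semigroup_pos (L : set nat) :
  numerical_semigroup L -> exists2 t, 0 < t & L t.
Proof.
move=> Lns; apply: contrapT => no_t; suff: 2%N = 1%N by [].
apply: (numerical_semigroup_coprime Lns) => g Lg; case: (posnP g) => [->//|g0].
by case: no_t; exists g.
Qed.

Local Open Scope ring_scope.

Lemma pattern_eval_scale p t s :
  size s = size p ->
  pattern_eval p [seq (t * x)%N | x <- s] = t%:Z * pattern_eval p s.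
Proof.
move=> szs; rewrite /pattern_eval mulr_sumr; apply: eq_bigr => i _.
by rewrite (nth_map 0%N) ?szs // PoszM mulrCA.
Qed.

Lemma pattern_eval_cons c p x s :
  pattern_eval (c :: p) (x :: s) = c * x%:Z + pattern_eval p s.
Proof. by rewrite /pattern_eval big_ord_recl. Qed.

(** The entries of [s] are arbitrary; scaling by a positive [t] in a semigroup admitting [p] moves
    them into it, and the value is only multiplied by [t]. *)
Lemma admissible_eval_ge0 p s :
  admissible p -> size s = size p -> sorted geq s -> 0 <= pattern_eval p s.
Proof.
move=> [L [Lns Ladm]] szs s_sorted.
have [t t_gt0 Lt] := numerical_semigroup_pos Lns.
have [||x|y _] := Ladm [seq (t * x)%N | x <- s].
- by rewrite size_map.
- by apply: homo_sorted s_sorted => x y /= le_yx; rewrite leq_mul2l le_yx orbT.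
- by case/mapP=> u _ ->; rewrite mulnC; apply: submonoid_muln Lns.1 Lt.
by rewrite pattern_eval_scale // => e; rewrite -(@pmulr_rge0 _ t%:Z) ?e.
Qed.

(** The difference of [p(s)] and the largest entry [x1] is a value of the derived pattern: at [s] if
    the leading coefficient exceeds 1, at the tail of [s] if it equals 1. *)
Lemma pattern_eval_ge p s x :
  pattern p -> strongly_admissible p -> size s = size p -> sorted geq s ->
  x \in s -> x%:Z <= pattern_eval p s.
Proof.
case: p s => [|c p] [|x1 s] //= p_pat [p_adm p'_adm] [szs] s_sorted x_in.
have le_x_x1 : (x <= x1)%N.
  move: x_in; rewrite inE => /predU1P[->//|xs].
  have geq_trans : transitive geq by move=> a b d /= ab /leq_trans; apply.
  by have /allP/(_ _ xs) := order_path_min geq_trans s_sorted.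
suff: x1%:Z <= pattern_eval (c :: p) (x1 :: s) by lia.
move: p'_adm => /=; case: ifPn => [_|c_le1] p'_adm.
  have := admissible_eval_ge0 (s := x1 :: s) p'_adm (congr1 S szs) s_sorted.
  by rewrite !pattern_eval_cons; lia.
have c_ge0 : 0 <= c.
  (* The value at [(1, 0, ..., 0)] is the leading coefficient [c]. *)
  have := @admissible_eval_ge0 _ (1%N :: nseq (size p) 0%N) p_adm.
  rewrite pattern_eval_cons /= size_nseq.
  have -> : pattern_eval p (nseq (size p) 0%N) = 0.
    by rewrite /pattern_eval big1 // => i _; rewrite nth_nseq if_same mulr0.
  rewrite addr0 mulr1; apply=> //.
  by case: (size p) => //= n; elim: n.
have c_neq0 : c != 0 by apply: p_pat; rewrite mem_head.
have -> : c = 1 by lia.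
have := admissible_eval_ge0 p'_adm szs (path_sorted s_sorted).
by rewrite pattern_eval_cons; lia.
Qed.

(** If [a] is the least element of [L] outside [G], then [a] is neither a sum nor a value of [p] on
    [L \ {a}], since the arguments would be smaller and hence in [G]; so [a] is removable. [G] need
    not be cofinite, which allows the multiples of [d] below. *)
Lemma removable_induction p L G :
  pattern p -> strongly_admissible p -> semigroups_admitting p L ->
  submonoid G ->
  (forall s y, size s = size p -> sorted geq s -> (forall x, x \in s -> G x) ->
     pattern_eval p s = y%:Z -> G y) ->
  removable p L `<=` G -> L `<=` G.
Proof.
move=> p_pat p_sadm [[[L0 LD] Lfin] Ladm] [G0 GD] Gp MG.
elim/ltn_ind => a IH La; apply: contrapT => NGa; apply: NGa.
have [//|NGa] := pselect (G a).
have small x : (x <= a)%N -> (L `\ a) x -> G x.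
  move=> le_xa [Lx /= neq_xa]; apply: IH => //.
  by rewrite ltn_neqAle le_xa andbT; apply/eqP.
apply: MG; split=> //; split; [split; [split|]|].
- by split=> // a0; apply: NGa; rewrite -a0.
- move=> x y La'x La'y; split; first exact: LD La'x.1 La'y.1.
  move=> /= xy_a; apply: NGa; rewrite -xy_a.
  by apply: GD; apply: small; rewrite // -xy_a (leq_addr, leq_addl).
- apply: (@sub_finite_set _ _ (~` L `|` [set a])); last first.
    by rewrite finite_setU; split.
  move=> x /= NLax; have [->|neq_xa] := pselect (x = a); first by right.
  by left=> Lx; apply: NLax.
move=> s szs s_sorted La's.
have [||x /La's[]//|y Ly ps] := Ladm s => //.
exists y => //; split=> //= ya; apply: NGa; rewrite -ya.
apply: (Gp s) => // x xs; apply: small; last exact: La's.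
have := pattern_eval_ge p_pat p_sadm szs s_sorted xs.
by rewrite ps ya lez_nat.
Qed.

Lemma generated_submonoid A : submonoid (generated A).
Proof.
split=> [G [[]]//|x y Ax Ay G GA]; case: (GA) => [[_ GD] _].
by apply: GD; [exact: Ax|exact: Ay].
Qed.

Lemma removable_generating_system p L :
  pattern p -> strongly_admissible p -> semigroups_admitting p L ->
  generating_system p L (removable p L).
Proof.
move=> p_pat p_sadm Ladm; have [Lns Lp] := Ladm; set M := removable p L.
have sub_gen : M `<=` generated M by exact: sub_smallest.
split.
  have Gm := generated_submonoid M; split=> //.
  apply: (cofinite_submonoid_coprime Gm) => d dG.
  apply: (numerical_semigroup_coprime Lns).
  (* Here [G] is the set of multiples of [d], closed under [p] by linearity. *)
  apply: (removable_induction p_pat p_sadm Ladm) => [||a /sub_gen/dG//].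
    by split=> [|x y dx dy]; rewrite /= ?dvdn0 ?dvdn_add.
  move=> s y szs _ ds ps; suff: (d%:Z %| y%:Z)%Z by [].
  rewrite -ps; apply: rpred_sum => i _; apply: dvdz_mull.
  by apply/ds/mem_nth; rewrite szs.
apply/seteqP; split.
  apply: smallest_sub => //; apply: smallest_sub Lns.1 _.
  by move=> a [].
(* Now [G] is any semigroup admitting [p] that contains [generated M]. *)
move=> a La G [[Gns Gp] MG].
apply: (removable_induction p_pat p_sadm Ladm Gns.1) La => [s y szs ss Gs ps|].
  by have [z Gz] := Gp s szs ss Gs; rewrite ps => -[->].
by move=> x /sub_gen/MG.
Qed.

Lemma removable_sub_generating_system p L A :
  generating_system p L A -> removable p L `<=` A.
Proof.
move=> [_ clA] a [La La'adm]; apply: contrapT => NAa.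
have AL : A `<=` L.
  rewrite -clA => x Ax G [_]; apply; exact: (@sub_smallest _ _ A A).
have: L `<=` L `\ a; last by move=> /(_ _ La) [_]; apply.
rewrite -{1}clA; apply: smallest_sub => //.
apply: smallest_sub La'adm.1.1 _ => x Ax; split; first exact: AL.
by move=> /= xa; apply: NAa; rewrite -xa.
Qed.

(** A least system is the only minimal one, so [get] has a witness and returns it. *)
Lemma the_minimal_generating_system_removable p L :
  pattern p -> strongly_admissible p -> semigroups_admitting p L ->
  the_minimal_generating_system p L = removable p L.
Proof.
move=> p_pat p_sadm Ladm.
have Mgen := removable_generating_system p_pat p_sadm Ladm.
have Muniq : unique (minimal_generating_system p L) (removable p L).
  split=> [|A [Agen Amin]].
    split=> // B /removable_sub_generating_system MB BM.
    by apply/seteqP; split.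
  by apply: Amin => //; apply: removable_sub_generating_system.
have [get_min _] := getPex (ex_intro _ _ Muniq).
exact/esym/Muniq.2.
Qed.

Theorem lemma31 (p : seq int) (L : set nat) (a : nat)
    (p_pattern : pattern p)
    (p_sadm : strongly_admissible p)
    (p_premonic : premonic p)
    (L_admits : semigroups_admitting p L)
    (a_in_L : L a) :
  the_minimal_generating_system p L a <-> semigroups_admitting p (L `\ a).
Proof.
rewrite the_minimal_generating_system_removable //.
by split=> [[]|].
Qed.
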